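(* For a nonnegative integer $n$, $$\sum_{p+q=2n+1}(p+1)\zeta^\star(\{1\}^{p+1},q+2)-\sum_{p+q=2n+1}G_{q+2}(1,p)=\binom{2n+4}{3}\zeta(2n+4)+\sum_{j=1}^n(-1)^j\sum_{|c_j|=2n+1-2j}\zeta(c_{j0}+3,c_{j1}+2,\ldots,c_{jj}+2)\,W(c_j),$$ where $W(c_j)=W(c_{j0},c_{j1},\ldots,c_{jj})=\binom{c_{j0}+3}{3}(c_{j1}+1)\cdots(c_{jj}+1)$.
   Context: $\zeta(\alpha_1,\ldots,\alpha_k)=\sum_{1\le k_1<\cdots<k_k}k_1^{-\alpha_1}\cdots k_k^{-\alpha_k}$; $\zeta^\star(\alpha_1,\ldots,\alpha_k)=\sum_{1\le k_1\le\cdots\le k_k}k_1^{-\alpha_1}\cdots k_k^{-\alpha_k}$; $\{a\}^k$ denotes $k$ repetitions of $a$. The sums over $p+q=2n+1$ are over nonnegative integers $p,q$. For each $j$, $\sum_{|c_j|=2n+1-2j}$ is over all $(j+1)$-tuples $c_j=(c_{j0},c_{j1},\ldots,c_{jj})$ of nonnegative integers with $c_{j0}+c_{j1}+\cdots+c_{jj}=2n+1-2j$. For nonnegative integers $n,p,q$, $$G_{n+2}(p,q)=\sum_{1\le k_1<\cdots<k_{p+1}}\frac{1}{k_1\cdots k_p\,k_{p+1}^{n+2}}\sum_{1\le \ell_1\le\cdots\le\ell_q\le k_{p+1}}\frac{1}{\ell_1\cdots\ell_q}.$$ *)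

(* Defs.v *)
From HB Require Import structures.
From mathcomp Require Import all_boot all_order all_algebra.
From mathcomp Require Import all_classical all_reals all_analysis.
Set Implicit Arguments. Unset Strict Implicit. Unset Printing Implicit Defensive.
Import Order.TTheory GRing.Theory Num.Theory numFieldNormedType.Exports.
Local Open Scope ring_scope.

Section MZV.
Variable R : realType.

(* Truncated nested sums.  [rs] is the list of exponents in REVERSED order
   (head = exponent of the largest index).
   msum_lt rs N = sum_{1 <= k_1 < ... < k_r <= N} prod k_i^{-a_i}
   msum_le rs N = sum_{1 <= k_1 <= ... <= k_r <= N} prod k_i^{-a_i} *)
Fixpoint msum_lt (rs : seq nat) (N : nat) : R :=
  match rs with
  | [::] => 1
  | a :: rs' => \sum_(1 <= k < N.+1) (k%:R ^- a) * msum_lt rs' k.-1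
  end.

Fixpoint msum_le (rs : seq nat) (N : nat) : R :=
  match rs with
  | [::] => 1
  | a :: rs' => \sum_(1 <= k < N.+1) (k%:R ^- a) * msum_le rs' k
  end.

Definition mzv (s : seq nat) : R := limn (fun N => msum_lt (rev s) N).
Definition mzv_star (s : seq nat) : R := limn (fun N => msum_le (rev s) N).

(* G_m(p,q) = sum_{1<=k_1<...<k_{p+1}} 1/(k_1...k_p k_{p+1}^m)
               * sum_{1<=l_1<=...<=l_q<=k_{p+1}} 1/(l_1...l_q),
   truncated at k_{p+1} <= N.  (The paper's G_{n+2} is G (n+2).) *)
Definition G_trunc (m p q N : nat) : R :=
  \sum_(1 <= k < N.+1)
     (k%:R ^- m) * msum_lt (nseq p 1%N) k.-1 * msum_le (nseq q 1%N) k.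
Definition G (m p q : nat) : R := limn (G_trunc m p q).

End MZV.

(* Main.v *)
Require Import Defs.
From HB Require Import structures.
From mathcomp Require Import all_boot all_order all_algebra.
From mathcomp Require Import all_classical all_reals all_analysis.
From mathcomp Require Import ring lra zify.
Import Order.TTheory GRing.Theory Num.Theory numFieldNormedType.Exports.
Set Implicit Arguments. Unset Strict Implicit. Unset Printing Implicit Defensive.
Local Open Scope ring_scope.
Local Open Scope classical_set_scope.

(* Encode both sides as generating functions in t, i.e. formal power series.
   With r_k = 1/(k - t), v_k = 1/k, P_k = prod_(i <= k) i r_i and
   e_k = v_k P_k (sum_(i <= k) r_i - sum_(i < k) v_i), the coefficient of
   t^(2n+1) in sum_(k <= N) r_k e_k is the left-hand side of the theorem
   truncated at N, and that of
     U_N = sum_(i <= N) i r_i^4 prod_(i < l <= N) (1 - t^2 r_l^2)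
   is the truncated right-hand side.  For every N one has the exact identity
     sum_(k <= N) (P_N / P_(N-k)) r_k e_k = U_N,
   proved by induction on N: the two sides satisfy the same recurrence because
   the convolution of e_k with the coefficients of (1-x)^t is explicit.  The
   coefficients of P_N / P_(N-k) - 1 are O(k/N) times those of P_k, and P_k
   evaluated at t = 1/16 is at most (k+1)^(1/8), so dropping the factor
   P_N / P_(N-k) costs o(1) coefficientwise. *)

(** * The exact identity at level N *)

Section ExactIdentity.
Variables (A : comNzRingType) (t : A) (v r : nat -> A).
Hypothesis vK : forall k, (0 < k)%N -> k%:R * v k = 1.
Hypothesis rK : forall k, (0 < k)%N -> (k%:R - t) * r k = 1.

Definition prodP k := \prod_(1 <= i < k.+1) (i%:R * r i).
Definition prodQ k := \prod_(1 <= i < k.+1) (v i * (i%:R - t)).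
Definition bterm k := v k * prodP k.
Definition harm k := \sum_(1 <= i < k.+1) v i.
Definition rsum k := \sum_(1 <= i < k.+1) r i.
Definition eterm k := bterm k * (rsum k - harm k.-1).
(* [qterm j] is the coefficient of x^j in (1 - x)^t. *)
Definition qterm k := if k is k'.+1 then - t * v k * prodQ k' else 1.

(** Serves to clear denominators, since [A] is only a commutative ring. *)
Lemma unit_cancel (x y a b : A) : x * y = 1 -> x * a = x * b -> a = b.
Proof.
by move=> xy xab; rewrite -[a]mul1r -[b]mul1r -xy [x * y]mulrC -!mulrA xab.
Qed.

Lemma prodPS k : prodP k.+1 = prodP k * (k.+1%:R * r k.+1).
Proof. by rewrite /prodP big_nat_recr. Qed.

Lemma prodQS k : prodQ k.+1 = prodQ k * (v k.+1 * (k.+1%:R - t)).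
Proof. by rewrite /prodQ big_nat_recr. Qed.

Lemma prodP_Q k : prodP k * prodQ k = 1.
Proof.
elim: k => [|k IH]; first by rewrite /prodP /prodQ !big_geq // mulr1.
rewrite prodPS prodQS.
transitivity ((prodP k * prodQ k) * (k.+1%:R * v k.+1) * ((k.+1%:R - t) * r k.+1)).
  by ring.
by rewrite IH vK // rK // !mulr1.
Qed.

(** [prodQ k] is the coefficient of x^k in (1 - x)^(t - 1); multiplying that series by 1 - x gives
    (1 - x)^t. *)
Lemma prodQ_qterm k : prodQ k.+1 = prodQ k + qterm k.+1.
Proof.
rewrite prodQS /=.
transitivity (prodQ k * (k.+1%:R * v k.+1) - prodQ k * v k.+1 * t); first by ring.
by rewrite vK // mulr1; ring.
Qed.

(** Coefficient form of the differential equation (1 - x) y' = - t y of (1 - x)^t. *)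
Lemma qtermS k : k.+1%:R * qterm k.+1 = (k%:R - t) * qterm k.
Proof.
rewrite [qterm k.+1]/=.
transitivity (- t * (k.+1%:R * v k.+1) * prodQ k); first by ring.
rewrite vK // mulr1; case: k => [|k] /=; first by rewrite /prodQ big_geq //; ring.
by rewrite prodQS; ring.
Qed.

Lemma bterm_rec k : (k.+2%:R - t) * bterm k.+2 = k.+1%:R * bterm k.+1.
Proof.
rewrite /bterm prodPS.
transitivity ((k.+2%:R - t) * r k.+2 * (k.+2%:R * v k.+2) * prodP k.+1).
  by ring.
by rewrite rK // vK // !mul1r mulrA vK // mul1r.
Qed.

Lemma bterm1 : (1 - t) * bterm 1 = 1.
Proof.
rewrite /bterm prodPS {1}/prodP big_geq //.
transitivity ((1%:R - t) * r 1 * (1%:R * v 1%N)); first by ring.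
by rewrite rK // vK // mulr1.
Qed.

(** With b_k(u) = (1 - u)_(k-1) / (1 - t - u)_k, this is the u-derivative at 0 of (k + 2 - t - u)
    b_(k+2)(u) = (k + 1 - u) b_(k+1)(u). *)
Lemma eterm_rec k :
  (k.+2%:R - t) * eterm k.+2 = bterm k.+2 - bterm k.+1 + k.+1%:R * eterm k.+1.
Proof.
have e1 : k.+1%:R * bterm k.+1 * r k.+2 = bterm k.+2.
  by rewrite -bterm_rec mulrAC rK // mul1r.
have e2 : k.+1%:R * bterm k.+1 * v k.+1 = bterm k.+1 by rewrite mulrAC vK // mul1r.
rewrite {1}/eterm [LHS]mulrA bterm_rec /=.
have -> : rsum k.+2 = rsum k.+1 + r k.+2 by rewrite /rsum big_nat_recr.
have -> : harm k.+1 = harm k + v k.+1 by rewrite /harm big_nat_recr.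
transitivity (k.+1%:R * bterm k.+1 * r k.+2 - k.+1%:R * bterm k.+1 * v k.+1
  + k.+1%:R * (bterm k.+1 * (rsum k.+1 - harm k))); first by ring.
by rewrite e1 e2.
Qed.

Lemma eterm1 : (1 - t) * eterm 1 = bterm 1.
Proof.
rewrite /eterm /harm big_geq // subr0 mulrA bterm1 mul1r /rsum big_nat1.
apply: (@unit_cancel (1%:R - t) (r 1%N)); first by rewrite rK.
by rewrite rK // -[1%:R]/(1 : A) bterm1.
Qed.

Definition qconv (x : nat -> A) N := \sum_(1 <= k < N.+1) x k * qterm (N - k).

(** Split N + 1 - t as (k - t) + (N + 1 - k); [qtermS] absorbs the second part into the kernel, and
    it vanishes at k = N + 1. *)
Lemma qconvS (x : nat -> A) N :
  (N.+1%:R - t) * qconv x N.+1 =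
  \sum_(1 <= k < N.+2) (k%:R - t) * x k * qterm (N.+1 - k)
  + \sum_(1 <= k < N.+1) ((N - k)%:R - t) * x k * qterm (N - k).
Proof.
rewrite /qconv mulr_sumr [in RHS]big_nat_recr //= big_nat_recr //=.
rewrite [RHS]addrAC -big_split /= !subnn; congr (_ + _); last by ring.
apply: eq_big_nat => k /andP[k0 kN].
rewrite ltnS in kN; rewrite (subSn kN) [((N - k)%:R - t) * x k]mulrC.
rewrite -[x k * _ * _]mulrA -qtermS.
have -> : N.+1%:R = k%:R + (N - k).+1%:R :> A by rewrite -natrD; congr _%:R; lia.
by ring.
Qed.

(* [bterm] is (1 - u)_(k-1) / (1 - t - u)_k at u = 0 and [eterm] is its
   u-derivative there; this lemma and [qconv_eterm] are the Chu-Vandermonde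
   evaluation and its derivative. *)
Lemma qconv_bterm N : (N.+1%:R - t) * qconv bterm N.+1 = prodQ N.
Proof.
elim: N => [|N IH].
  by rewrite /qconv big_nat1 subnn /= mulr1 bterm1 /prodQ big_geq.
rewrite qconvS big_nat_recl // mulr1n bterm1 mul1r subSS subn0 prodQ_qterm.
rewrite -addrA addrC -IH; congr (_ + _).
(* By [bterm_rec] the two sums recombine into the convolution at the previous level; the k = 1 term
   set aside is the increment of [prodQ]. *)
rewrite -big_split /= /qconv mulr_sumr; apply: eq_big_nat => k /andP[k0 kN].
case: k k0 kN => // k _ kN; rewrite bterm_rec !subSS.
have -> : N.+1%:R = k.+1%:R + (N - k)%:R :> A by rewrite -natrD; congr _%:R; lia.
by ring.
Qed.

Lemma qconv_eterm N : (N.+1%:R - t) * qconv eterm N.+1 = qconv bterm N.+1.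
Proof.
elim: N => [|N IH].
  by rewrite /qconv !big_nat1 subnn /= !mulr1 eterm1.
rewrite qconvS big_nat_recl // mulr1n eterm1 subSS subn0.
rewrite [RHS]big_nat_recl // subSS subn0 -!addrA; congr (_ + _).
rewrite -big_split /=.
(* The terms [- bterm k.+1] of [eterm_rec] add up to [- qconv bterm N.+1], which the induction
   hypothesis cancels. *)
transitivity (\sum_(1 <= k < N.+2) bterm k.+1 * qterm (N.+1 - k) - qconv bterm N.+1
   + (N.+1%:R - t) * qconv eterm N.+1); last first.
  by rewrite IH subrK; apply: eq_bigr => k _; rewrite subSS.
rewrite /qconv mulr_sumr -sumrB -big_split /=; apply: eq_big_nat => k /andP[k0 kN].
case: k k0 kN => // k _ kN; rewrite eterm_rec !subSS.
have -> : N.+1%:R = k.+1%:R + (N - k)%:R :> A by rewrite -natrD; congr _%:R; lia.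
by ring.
Qed.

Definition ratioPQ N k := prodP N * prodQ (N - k).
Definition lsum N := \sum_(1 <= k < N.+1) ratioPQ N k * (r k * eterm k).
Definition usum N :=
  \sum_(1 <= i < N.+1) i%:R * r i ^+ 4 * \prod_(i.+1 <= l < N.+1) (1 - t ^+ 2 * r l ^+ 2).

Lemma usumS N :
  usum N.+1 = (1 - t ^+ 2 * r N.+1 ^+ 2) * usum N + N.+1%:R * r N.+1 ^+ 4.
Proof.
rewrite /usum big_nat_recr //= [\prod_(N.+2 <= l < N.+2) _]big_geq // mulr1.
congr (_ + _); rewrite mulr_sumr; apply: eq_big_nat => k /andP[k0 kN].
by rewrite big_nat_recr //=; ring.
Qed.

(** With n = N + 1 and m = N + 1 - k, clearing denominators reduces this to (m - t)(n - t) - m (n -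
    2t) = - t (k - t). The factor k - t cancels [r k], so what remains depends on k only through N +
    1 - k and is a convolution kernel. *)
Lemma ratioPQ_rec N k : (0 < k)%N -> (k <= N)%N ->
  ratioPQ N.+1 k * r k - (1 - t ^+ 2 * r N.+1 ^+ 2) * (ratioPQ N k * r k)
  = prodP N.+1 * r N.+1 * qterm (N.+1 - k).
Proof.
move=> k0 kN; rewrite /ratioPQ subSn // /qterm prodQS prodPS.
set M := (N - k)%N; set p := prodP N; set a := prodQ M.
have NE : N.+1%:R = M.+1%:R + k%:R :> A by rewrite -natrD; congr _%:R; rewrite /M; lia.
have vM := vK (ltn0Sn M); have rN := rK (ltn0Sn N); have rk := rK k0.
apply: (unit_cancel rk); apply: (unit_cancel rN); apply: (unit_cancel rN).
apply: (unit_cancel (x := M.+1%:R) vM).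
set n : A := N.+1%:R in NE rN *; set m : A := M.+1%:R in NE vM *.
set x := r N.+1 in rN *; set y := r k in rk *; set w := v M.+1 in vM *.
set kk : A := k%:R in NE rk *.
have t1 : (n - t) * x = 1 := rN.
transitivity (p * a * ((kk - t) * y) *
   ((n - t) * n * ((n - t) * x) * (m - t) * (m * w)
    - (((n - t) ^+ 2) - t ^+ 2 * ((n - t) * x) ^+ 2) * m)).
  by ring.
rewrite t1 vM rk.
transitivity (p * a * (kk - t) * ((n - t) * x) * n * - t * (m * w) *
   ((n - t) * x)); last by ring.
by rewrite t1 vM NE; ring.
Qed.

Theorem lsum_usum N : lsum N = usum N.
Proof.
elim: N => [|N IH]; first by rewrite /lsum /usum !big_geq.
rewrite usumS -IH; apply/eqP; rewrite addrC -subr_eq; apply/eqP.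
(* The two evaluations give [qconv eterm N.+1] = [prodQ N] / (N + 1 - t)^2, and
   [prodP N.+1 * prodQ N] is (N + 1) [r N.+1]. *)
have -> : N.+1%:R * r N.+1 ^+ 4 = prodP N.+1 * r N.+1 * qconv eterm N.+1.
  apply: (unit_cancel (rK (ltn0Sn N))); apply: (unit_cancel (rK (ltn0Sn N))).
  transitivity ((N.+1%:R - t) * (prodP N.+1 * r N.+1 * ((N.+1%:R - t) * qconv eterm N.+1))).
    rewrite qconv_eterm.
    transitivity (prodP N.+1 * r N.+1 * ((N.+1%:R - t) * qconv bterm N.+1)); last by ring.
    rewrite qconv_bterm prodPS.
    transitivity ((N.+1%:R * r N.+1 ^+ 2 * ((N.+1%:R - t) * r N.+1) ^+ 2)); first by ring.
    rewrite rK // expr1n mulr1 -[LHS]mul1r -(prodP_Q N); ring.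
  by ring.
rewrite /lsum big_nat_recr //= addrAC /qconv !mulr_sumr -sumrB.
rewrite [in RHS]big_nat_recr //=; congr (_ + _); last first.
  by rewrite /ratioPQ subnn /= /prodQ big_geq //; ring.
apply: eq_big_nat => k /andP[k0 kN]; rewrite ltnS in kN.
rewrite mulrCA [RHS]mulrCA [RHS]mulrC -ratioPQ_rec //; ring.
Qed.

End ExactIdentity.

(** * Formal power series *)

(** A separate name, so that multiplication is the Cauchy product and not a pointwise one. *)
Definition fps (R : comNzRingType) := nat -> R.
HB.instance Definition _ (R : comNzRingType) := GRing.Zmodule.copy (fps R) (nat -> R).

Section FpsRing.
Variable R : comNzRingType.
Implicit Types f g h : fps R.

Definition fps_const (c : R) : fps R := fun n => if n is 0%N then c else 0.
Definition fps_mul f g : fps R := fun n => \sum_(i < n.+1) f i * g (n - i)%N.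

(** Coefficients of a product up to degree n depend only on those of the factors up to n, so the
    ring laws are inherited from polynomials. *)
Let trunc f n : {poly R} := \poly_(i < n.+1) f i.

Let trunc_mul f g n m : (m <= n)%N -> (trunc f n * trunc g n)`_m = fps_mul f g m.
Proof.
move=> mn; rewrite coefM; apply: eq_bigr => i _; rewrite !coef_poly.
by rewrite !ifT //; case: i => i /=; lia.
Qed.

Let trunc_coef f n m : (m <= n)%N -> (trunc f n)`_m = f m.
Proof. by move=> mn; rewrite coef_poly ltnS mn. Qed.

Let fps_mulA : associative fps_mul.
Proof.
move=> f g h; apply/funext => n.
transitivity ((trunc f n * (trunc g n * trunc h n))`_n).
  rewrite coefM; apply: eq_bigr => i _.
  by rewrite trunc_coef ?trunc_mul ?leq_subr // -ltnS.
rewrite mulrA coefM; apply: eq_bigr => i _.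
by rewrite trunc_coef ?leq_subr // trunc_mul // -ltnS.
Qed.

Let fps_mulC : commutative fps_mul.
Proof.
by move=> f g; apply/funext => n; rewrite -!(@trunc_mul _ _ n) // mulrC.
Qed.

Let fps_mul1 : left_id (fps_const 1) fps_mul.
Proof.
move=> f; apply/funext => n; rewrite /fps_mul big_ord_recl /= subn0 mul1r.
by rewrite big1 ?addr0 // => i _; rewrite mul0r.
Qed.

Let fps_mulDl : left_distributive fps_mul +%R.
Proof.
move=> f g h; apply/funext => n.
rewrite -[RHS]/(fps_mul f h n + fps_mul g h n) -big_split /=.
by apply: eq_bigr => i _; rewrite mulrDl.
Qed.

Let fps_1neq0 : fps_const 1 != 0 :> fps R.
Proof. by apply/eqP => /(congr1 (fun f : fps R => f 0%N)) /eqP; rewrite oner_eq0. Qed.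

HB.instance Definition _ :=
  GRing.Zmodule_isComNzRing.Build (fps R) fps_mulA fps_mulC fps_mul1 fps_mulDl fps_1neq0.

Lemma fpsM f g n : (f * g) n = \sum_(i < n.+1) f i * g (n - i)%N.
Proof. by []. Qed.
Lemma fpsM0 f g : (f * g) 0%N = f 0%N * g 0%N.
Proof. by rewrite fpsM big_ord1. Qed.
Lemma fpsD f g n : (f + g) n = f n + g n.
Proof. by []. Qed.
Lemma fpsB f g n : (f - g) n = f n - g n.
Proof. by []. Qed.
Lemma fps0 n : (0 : fps R) n = 0.
Proof. by []. Qed.
Lemma fps1 n : (1 : fps R) n = (n == 0%N)%:R.
Proof. by case: n. Qed.

Lemma fps_sum (I : Type) (s : seq I) (P : pred I) (F : I -> fps R) n :
  (\sum_(i <- s | P i) F i) n = \sum_(i <- s | P i) F i n.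
Proof. exact: (big_morph (fun f : fps R => f n)). Qed.

Lemma fps_constM c f n : (fps_const c * f) n = c * f n.
Proof.
rewrite fpsM big_ord_recl /= subn0 big1 ?addr0 // => i _.
by rewrite mul0r.
Qed.

Lemma fps_natr k : k%:R = fps_const k%:R :> fps R.
Proof.
elim: k => [|k IH]; apply/funext => n.
  by rewrite mulr0n; case: n.
by rewrite -addn1 !natrD IH fpsD; case: n => //= n; rewrite add0r.
Qed.

Lemma fps_natM k f n : (k%:R * f) n = k%:R * f n.
Proof. by rewrite fps_natr fps_constM. Qed.

Definition fpsX : fps R := fun n => (n == 1%N)%:R.

Lemma fpsXM f n : (fpsX * f) n = if n is n'.+1 then f n' else 0.
Proof.
case: n => [|n]; first by rewrite fpsM big_ord1 mul0r.
rewrite fpsM !big_ord_recl /= mul0r add0r mul1r big1 ?addr0 ?subSS ?subn0 //.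
by move=> i _; rewrite mul0r.
Qed.

Lemma fpsXnM j f n : (fpsX ^+ j * f) n = if (j <= n)%N then f (n - j)%N else 0.
Proof.
elim: j n => [|j IH] n; first by rewrite expr0 mul1r subn0.
by rewrite exprS -mulrA fpsXM; case: n => // n; rewrite IH subSS.
Qed.

Definition geo (x : R) : fps R := fun n => x ^+ n.

(** From geo = 1 + x t geo. It drives the coefficient inductions below. *)
Lemma geoM x f n :
  (geo x * f) n.+1 = f n.+1 + x * (geo x * f) n.
Proof.
rewrite mulrC !fpsM big_ord_recr /= subnn [geo x _]expr0 mulr1 addrC mulr_sumr.
congr (_ + _); apply: eq_bigr => i _; rewrite /geo subSn ?exprS; last by rewrite -ltnS.
by rewrite mulrCA.
Qed.

Lemma geoK x : (1 - fps_const x * fpsX) * geo x = 1.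
Proof.
apply/funext => n; rewrite mulrBl mul1r fpsB -mulrA fps_constM fpsXM fps1 /geo.
by case: n => [|n]; rewrite ?mulr0 ?subr0 // exprS subrr.
Qed.
End FpsRing.

(** * Coefficients of the generating functions *)

Section Coefficients.
Variable R : realType.
Implicit Types k p n : nat.

Definition vf k : fps R := fps_const k%:R^-1.
(* The series 1/(k - t); junk for k = 0. *)
Definition rf k : fps R := vf k * geo k%:R^-1.

Lemma vf_natK k : (0 < k)%N -> k%:R * vf k = 1.
Proof.
move=> k0; apply/funext => n; rewrite fps_natM fps1.
by case: n => [|n] /=; rewrite ?mulr0 // divff // pnatr_eq0 -lt0n.
Qed.

Lemma nat_rf k : (0 < k)%N -> k%:R * rf k = geo k%:R^-1.
Proof. by move=> k0; rewrite mulrA vf_natK // mul1r. Qed.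

Lemma rf_natK k : (0 < k)%N -> (k%:R - fpsX R) * rf k = 1.
Proof.
move=> k0; rewrite -[RHS](geoK (k%:R^-1 : R)) -(nat_rf k0) -/(vf k).
transitivity ((k%:R - k%:R * vf k * fpsX R) * rf k); last by ring.
by rewrite vf_natK // mul1r.
Qed.

Lemma rf_coef k n : rf k n = k%:R ^- n.+1.
Proof. by rewrite /rf /vf fps_constM /geo exprS invfM exprVn. Qed.

Lemma rf2_coef k n : (rf k ^+ 2) n = n.+1%:R * k%:R ^- (n + 2).
Proof.
rewrite expr2 fpsM (eq_bigr (fun=> k%:R ^- (n + 2))); last first.
  move=> [i /= ilt] _; rewrite !rf_coef -invfM -exprD; congr (_ ^- _); lia.
by rewrite sumr_const card_ord mulr_natl.
Qed.

(** The series is k^-3 (1 - t/k)^-4; each further factor [geo] raises the binomial coefficient by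
    Pascal's rule. *)
Lemma nat_rf4_coef k n : (0 < k)%N ->
  (k%:R * rf k ^+ 4) n = 'C(n + 3, 3)%:R * k%:R ^- (n + 3).
Proof.
move=> k0; have -> : k%:R * rf k ^+ 4 = geo k%:R^-1 * rf k * rf k ^+ 2.
  by rewrite -nat_rf //; ring.
have h3 m : (geo k%:R^-1 * rf k ^+ 2 : fps R) m = 'C(m.+2, 2)%:R * k%:R ^- (m + 2).
  elim: m => [|m IH].
    by rewrite fpsM big_ord1 rf2_coef /geo expr0 !mul1r.
  rewrite geoM IH rf2_coef [in RHS]binS bin1 natrD [in RHS]mulrDl.
  rewrite [LHS]addrC; congr (_ + _); rewrite mulrCA; congr (_ * _).
  by rewrite addSn exprS invfM.
have -> : geo k%:R^-1 * rf k * rf k ^+ 2 =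
    fps_const k%:R^-1 * (geo k%:R^-1 * (geo k%:R^-1 * rf k ^+ 2)) :> fps R.
  by rewrite {1}/rf /vf; ring.
rewrite fps_constM.
have -> : (geo k%:R^-1 * (geo k%:R^-1 * rf k ^+ 2) : fps R) n =
    'C(n + 3, 3)%:R * k%:R ^- (n + 2).
  elim: n => [|n IH].
    by rewrite fpsM big_ord1 h3 /geo expr0 mul1r.
  rewrite geoM IH h3 addSn !addn2 !addn3 [in RHS]binS natrD [in RHS]mulrDl [LHS]addrC.
  congr (_ + _); rewrite mulrCA; congr (_ * _).
  by rewrite -invfM -exprS.
by rewrite mulrCA addn2 addn3 -invfM -exprS.
Qed.

Definition PF k : fps R := prodP rf k.

Lemma PFS k : PF k.+1 = geo k.+1%:R^-1 * PF k.
Proof. by rewrite /PF prodPS nat_rf // mulrC. Qed.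

Lemma msum_le1S p k :
  msum_le R (nseq p.+1 1%N) k.+1 =
  msum_le R (nseq p.+1 1%N) k + k.+1%:R^-1 * msum_le R (nseq p 1%N) k.+1.
Proof. by rewrite /= big_nat_recr //= expr1. Qed.

(** The product of the 1/(1 - t/i) generates the complete homogeneous symmetric polynomials in 1,
    1/2, ..., 1/k; both sides obey the recurrence that splits off the largest index. *)
Lemma PF_coef k p : PF k p = msum_le R (nseq p 1%N) k.
Proof.
elim: k p => [|k IHk] p.
  by rewrite /PF /prodP big_geq // fps1; case: p => //= p; rewrite big_geq.
elim: p => [|p IHp]; rewrite PFS.
  by rewrite fpsM big_ord1 /geo expr0 mul1r subn0 IHk.
by rewrite geoM -PFS IHp IHk msum_le1S.
Qed.

(** [rsum] is the logarithmic derivative of [PF k] in t, so the product is the derivative of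
    [PF k]. *)
Lemma PF_rsum_coef k p :
  (PF k * rsum rf k) p = p.+1%:R * PF k p.+1.
Proof.
elim: k p => [|k IHk] p.
  by rewrite /rsum big_geq // mulr0 fps0 /PF /prodP big_geq // fps1 mulr0.
have -> : PF k.+1 * rsum rf k.+1 =
    geo k.+1%:R^-1 * (PF k * rsum rf k + vf k.+1 * PF k.+1).
  rewrite /rsum big_nat_recr //= -/(rsum _ k) mulrDr {1}PFS.
  rewrite -mulrA [RHS]mulrDr; congr (_ + _).
  by rewrite [RHS]mulrCA [RHS]mulrA [RHS]mulrC.
elim: p => [|p IHp].
  rewrite fpsM0 /geo expr0 mul1r fpsD fps_constM IHk PFS geoM.
  by rewrite !mul1r.
rewrite geoM IHp fpsD fps_constM IHk PFS !geoM -PFS.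
by rewrite -[in RHS]addn1 natrD; rewrite -[in LHS](addn1 p.+1) natrD; ring.
Qed.
Lemma rf_vf_coef k n : (rf k * vf k) n = k%:R ^- (n + 2).
Proof.
by rewrite mulrC /vf fps_constM rf_coef -invfM -exprS addn2.
Qed.

Lemma harm_const k : harm vf k = fps_const (msum_lt R [:: 1%N] k).
Proof.
elim: k => [|k IH].
  by rewrite /harm /= !big_geq //; apply/funext; case.
rewrite /harm big_nat_recr // -/(harm vf k) IH.
have -> : msum_lt R [:: 1%N] k.+1 = msum_lt R [:: 1%N] k + k.+1%:R^-1.
  by rewrite /= big_nat_recr //= mulr1.
by apply/funext; case => [|n] //; exact: addr0.
Qed.

Lemma rf_eterm_coef k m :
  (rf k * eterm vf rf k) m =
  \sum_(p < m.+1) k%:R ^- (m - p + 2) *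
    (p.+1%:R * msum_le R (nseq p.+1 1%N) k
     - msum_lt R (nseq 1 1%N) k.-1 * msum_le R (nseq p 1%N) k).
Proof.
have -> : rf k * eterm vf rf k =
    (PF k * rsum rf k - harm vf k.-1 * PF k) * (rf k * vf k).
  by rewrite /eterm /bterm -/(PF k); ring.
rewrite fpsM; apply: eq_bigr => p _.
by rewrite rf_vf_coef fpsB PF_rsum_coef harm_const fps_constM !PF_coef [LHS]mulrC.
Qed.

(** At m = 2n + 1 this is the truncated left-hand side: the derivative of [PF] supplies the weight p
    + 1, the harmonic number in [eterm] the sums G. *)
Lemma sum_rf_eterm_coef N m :
  (\sum_(1 <= k < N.+1) rf k * eterm vf rf k) m =
  \sum_(p < m.+1) (p.+1%:R * msum_le R ((m - p + 2)%N :: nseq p.+1 1%N) N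
     - G_trunc R (m - p + 2) 1 p N).
Proof.
rewrite fps_sum; under eq_bigr do rewrite rf_eterm_coef.
rewrite exchange_big /=; apply: eq_bigr => p _.
rewrite /G_trunc mulr_sumr -sumrB; apply: eq_bigr => k _.
by rewrite mulrBr; congr (_ - _); [exact: mulrCA | exact: mulrA].
Qed.

(** The coefficient of (- t^2)^j when the product in [usum] is expanded: the smallest index carries
    k r_k^4, the j larger ones r_k^2. *)
Fixpoint Tf j N : fps R :=
  if j is j'.+1 then \sum_(1 <= k < N.+1) rf k ^+ 2 * Tf j' k.-1
  else \sum_(1 <= k < N.+1) k%:R * rf k ^+ 4.

Lemma Tf0 j N : (N <= j)%N -> Tf j N = 0.
Proof.
elim: j N => [|j IH] N Nj /=; first by rewrite big_geq //; lia.
by rewrite big_nat big1 // => k kN; rewrite IH ?mulr0 //; lia.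
Qed.

Lemma TfS j N : Tf j.+1 N.+1 = Tf j.+1 N + rf N.+1 ^+ 2 * Tf j N.
Proof. by rewrite /= big_nat_recr. Qed.

Lemma TfS0 N : Tf 0 N.+1 = Tf 0 N + N.+1%:R * rf N.+1 ^+ 4.
Proof. by rewrite /= big_nat_recr. Qed.

Arguments Tf : simpl never.

(** [M] is left free because the step from N to N + 1 needs the hypothesis at two cutoffs: [M.+1]
    for the old terms, [M] for those with the new factor r^2. *)
Lemma usum_Tf N M : (N <= M)%N ->
  usum (fpsX R) rf N = \sum_(j < M.+1) (- fpsX R ^+ 2) ^+ j * Tf j N.
Proof.
elim: N M => [|N IH] [|M] // NM.
- by rewrite /usum big_geq // big_ord1 Tf0 // mulr0.
- rewrite /usum big_geq // big1 // => j _.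
  by rewrite Tf0 ?mulr0.
rewrite usumS big_ord_recl expr0 mul1r TfS0.
under eq_bigr do rewrite lift0 TfS mulrDr.
have E1 := IH M.+1 (ltnW NM); rewrite big_ord_recl expr0 mul1r in E1.
have E2 : \sum_(i < M.+1) (- fpsX R ^+ 2) ^+ i.+1 * (rf N.+1 ^+ 2 * Tf i N) =
    - fpsX R ^+ 2 * rf N.+1 ^+ 2 * usum (fpsX R) rf N.
  by rewrite (IH M) // mulr_sumr; apply: eq_bigr => i _; rewrite exprS; ring.
rewrite big_split /= E2.
have -> : Tf 0 N = usum (fpsX R) rf N -
    \sum_(i < M.+1) (- fpsX R ^+ 2) ^+ i.+1 * Tf i.+1 N by rewrite E1 addrK.
ring.
Qed.

Lemma usum_coef N n :
  (usum (fpsX R) rf N) (2 * n + 1)%N =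
  \sum_(j < n.+1) (-1) ^+ j * Tf j N (2 * n + 1 - 2 * j)%N.
Proof.
(* The cutoff N + n is at least N and covers all j <= n; for j > n the factor t^(2j) has degree
   above 2n + 1. *)
rewrite (@usum_Tf N (N + n)) ?leq_addr // fps_sum.
rewrite (big_ord_widen (N + n).+1
  (fun j => (-1) ^+ j * Tf j N (2 * n + 1 - 2 * j)%N)) ?ltnS ?leq_addl //.
rewrite [RHS]big_mkcond; apply: eq_bigr => j _ /=.
have -> : (- fpsX R ^+ 2) ^+ j * Tf j N =
    fps_const ((-1) ^+ j) * (fpsX R ^+ (2 * j) * Tf j N).
  have -> : fps_const ((-1) ^+ j) = (-1) ^+ j :> fps R.
    elim: (j : nat) => [|i IH] //; rewrite !exprS -IH; apply/funext => i0.
    by rewrite mulN1r mulN1r -[RHS]/(- (fps_const _ _)); case: i0 => //=; rewrite oppr0.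
  by rewrite (exprNn (fpsX R ^+ 2)) -exprM mulrA.
rewrite fps_constM fpsXnM.
by case: ifP; case: ifP => //; rewrite ?mulr0 //; lia.
Qed.
End Coefficients.

(** * Tuples extended by a last entry *)

Section FfunSnoc.
Variables (j : nat) (T : finType).

Definition ffun_snoc (c : {ffun 'I_j -> T}) (d : T) : {ffun 'I_j.+1 -> T} :=
  [ffun i => if unlift ord_max i is Some i' then c i' else d].

Lemma ffun_snoc_lift c d i : ffun_snoc c d (lift ord_max i) = c i.
Proof. by rewrite ffunE liftK. Qed.

Lemma ffun_snoc_max c d : ffun_snoc c d ord_max = d.
Proof. by rewrite ffunE unlift_none. Qed.

Lemma big_ffun_snoc (V : nmodType) (P : pred {ffun 'I_j.+1 -> T})
    (F : {ffun 'I_j.+1 -> T} -> V) :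
  \sum_(c | P c) F c = \sum_(d : T) \sum_(c | P (ffun_snoc c d)) F (ffun_snoc c d).
Proof.
rewrite pair_big_dep /=.
rewrite (reindex (fun dc : T * {ffun 'I_j -> T} => ffun_snoc dc.2 dc.1)) //=.
exists (fun c => (c ord_max, [ffun i => c (lift ord_max i)])).
  move=> [d c] _ /=; rewrite ffun_snoc_max; congr (_, _).
  by apply/ffunP => i; rewrite ffunE ffun_snoc_lift.
move=> c _ /=; apply/ffunP => i; rewrite ffunE.
by case: unliftP => [i' ->|->]; rewrite ?ffunE.
Qed.
End FfunSnoc.

Lemma widen_ord_lift n (i : 'I_n) : widen_ord (leqnSn n) i = lift ord_max i.
Proof. by apply: val_inj; exact: esym (lift_max i). Qed.

Lemma lift_max_eq0 n (i : 'I_n.+1) : (lift ord_max i == ord0) = (i == ord0).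
Proof. by rewrite -[LHS]/((lift ord_max i : nat) == 0%N) lift_max. Qed.

(** * Coefficients of [Tf] as weighted truncated zeta values *)

Section TfExpansion.
Variable R : realType.

Definition exponents j B (c : {ffun 'I_j.+1 -> 'I_B}) : seq nat :=
  [seq (if i == ord0 then (c i + 3)%N else (c i + 2)%N) | i <- enum 'I_j.+1].

Definition weight j B (c : {ffun 'I_j.+1 -> 'I_B}) : R :=
  'C((c ord0 + 3)%N, 3)%:R * \prod_(i < j.+1 | i != ord0) ((c i : nat).+1)%:R.

Lemma exponents_snoc j B (c : {ffun 'I_j.+1 -> 'I_B}) d :
  exponents (ffun_snoc c d) = rcons (exponents c) (d + 2)%N.
Proof.
rewrite /exponents enum_ordSr map_rcons ffun_snoc_max /= -map_comp.
congr rcons; apply: eq_map => i /=.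
by rewrite widen_ord_lift ffun_snoc_lift lift_max_eq0.
Qed.

Lemma weight_snoc j B (c : {ffun 'I_j.+1 -> 'I_B}) d :
  weight (ffun_snoc c d) = d.+1%:R * weight c.
Proof.
rewrite /weight (_ : ord0 = lift ord_max ord0); last exact: val_inj.
rewrite ffun_snoc_lift mulrCA [d.+1%:R * _]mulrC; congr (_ * _).
rewrite big_mkcond big_ord_recr /= ffun_snoc_max [in RHS]big_mkcond /=; congr (_ * _).
apply: eq_bigr => i _; rewrite widen_ord_lift ffun_snoc_lift.
by rewrite (inj_eq lift_inj).
Qed.

Lemma sum_snoc j B (c : {ffun 'I_j.+1 -> 'I_B}) d :
  (\sum_(i < j.+2) (ffun_snoc c d i : nat) = \sum_(i < j.+1) (c i : nat) + d)%N.
Proof.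
rewrite big_ord_recr /= ffun_snoc_max; congr (_ + _)%N.
by apply: eq_bigr => i _; rewrite widen_ord_lift ffun_snoc_lift.
Qed.

(** The outermost sum of [Tf] runs over the largest index, hence over the last tuple entry d; by
    [rf2_coef] it contributes the exponent d + 2 and the weight d + 1. As s < B, the bound [B]
    excludes no tuple of sum s. *)
Lemma Tf_coef j B s N : (s < B)%N ->
  Tf R j N s = \sum_(c : {ffun 'I_j.+1 -> 'I_B} | (\sum_(i < j.+1) (c i : nat) == s)%N)
     msum_lt R (rev (exponents c)) N * weight c.
Proof.
elim: j s N => [|j IH] s N sB.
  rewrite /Tf fps_sum.
  rewrite (eq_bigl (pred1 [ffun=> Ordinal sB])); last first.
    move=> c; rewrite big_ord1; apply/eqP/eqP => [cs|->]; last by rewrite ffunE.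
    by apply/ffunP => i; rewrite ffunE (ord1 i); apply: val_inj.
  rewrite big_pred1_eq /weight [X in _ * (_ * X)]big_pred0; last by move=> i; rewrite (ord1 i) eqxx.
  rewrite /exponents enum_ordSl enum_ord0 /= !ffunE /= mulr1 mulrC mulr_sumr.
  by apply: eq_big_nat => k /andP[k0 _]; rewrite nat_rf4_coef // mulr1.
rewrite big_ffun_snoc /Tf -/(Tf R j) fps_sum.
under [RHS]eq_bigr => d _.
  under eq_bigr => c _.
    rewrite exponents_snoc rev_rcons weight_snoc /= mulr_suml.
    under eq_bigr do rewrite mulrACA.
    over.
  rewrite exchange_big /=.
  under eq_bigr => k _ do rewrite -mulr_sumr.
  over.
rewrite /= [RHS]exchange_big /=; apply: eq_bigr => k _.
rewrite fpsM.
rewrite (big_ord_widen B (fun i => (rf R k ^+ 2) i * Tf R j k.-1 (s - i)%N)) //.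
rewrite [LHS]big_mkcond; apply: eq_bigr => d _ /=.
(* For d > s no tuple ending in d has sum s, so widening the range of d to [B] adds only zeros. *)
case: ifPn => [ds|sd].
  rewrite rf2_coef IH; last by lia.
  rewrite [k%:R ^- _ * _]mulrC; congr (_ * _); apply: eq_bigl => c.
  by rewrite sum_snoc; lia.
rewrite big_pred0 ?mulr0 // => c; rewrite sum_snoc; lia.
Qed.
End TfExpansion.

(** * Estimates *)

Section Majorant.
Variables (R : realType) (x : R).
Hypothesis x0 : 0 <= x.
Implicit Types (f g : fps R) (v w : R).

(** Bounds the weighted l^1 norm at radius x through partial sums, which avoids any summability
    condition. *)
Definition dom f v := forall M, \sum_(m < M) `|f m| * x ^+ m <= v.

Lemma dom_ge0 f v : dom f v -> 0 <= v.
Proof. by move/(_ 0%N); rewrite big_ord0. Qed.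

Lemma dom_le f v w : dom f v -> v <= w -> dom f w.
Proof. by move=> fv vw M; apply: le_trans vw. Qed.

Lemma dom_coef f v m : dom f v -> `|f m| * x ^+ m <= v.
Proof.
move=> /(_ m.+1); rewrite big_ord_recr /=; apply: le_trans.
by rewrite lerDr sumr_ge0 // => i _; rewrite mulr_ge0 ?exprn_ge0.
Qed.

Lemma domD f g v w : dom f v -> dom g w -> dom (f + g) (v + w).
Proof.
move=> fv gw M; apply: le_trans (lerD (fv M) (gw M)).
rewrite -big_split /=; apply: ler_sum => m _.
by rewrite -mulrDl ler_wpM2r ?exprn_ge0 // ler_normD.
Qed.

Lemma domN f v : dom f v -> dom (- f) v.
Proof.
move=> fv M; apply: le_trans (fv M); apply: ler_sum => m _.
by rewrite -[(- f) m]/(- f m) normrN.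
Qed.

Lemma domB f g v w : dom f v -> dom g w -> dom (f - g) (v + w).
Proof. by move=> fv gw; apply: domD => //; apply: domN. Qed.

Lemma dom0 : dom 0 0.
Proof. by move=> M; rewrite big1 // => i _; rewrite fps0 normr0 mul0r. Qed.

Lemma dom_sum (s : seq nat) (F : nat -> fps R) (G : nat -> R) :
  (forall k, k \in s -> dom (F k) (G k)) ->
  dom (\sum_(k <- s) F k) (\sum_(k <- s) G k).
Proof.
elim: s => [|k s IH] FG; first by rewrite !big_nil; apply: dom0.
rewrite !big_cons; apply: domD; first by apply: FG; rewrite mem_head.
by apply: IH => i si; apply: FG; rewrite inE si orbT.
Qed.

(** The pairs of degrees i + l < M lie in the square i, l < M. *)
Lemma domM f g v w : dom f v -> dom g w -> dom (f * g) (v * w).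
Proof.
move=> fv gw M.
pose a i := `|f i| * x ^+ i; pose b i := `|g i| * x ^+ i.
have a0 i : 0 <= a i by rewrite mulr_ge0 ?exprn_ge0.
have b0 i : 0 <= b i by rewrite mulr_ge0 ?exprn_ge0.
have le1 : \sum_(m < M) `|(f * g) m| * x ^+ m <=
    \sum_(m < M) \sum_(i < M | (i <= m)%N) a i * b (m - i)%N.
  apply: ler_sum => m _.
  have -> : \sum_(i < M | (i <= m)%N) a i * b (m - i)%N = \sum_(i < m.+1) a i * b (m - i)%N.
    by rewrite (big_ord_widen M (fun i => a i * b (m - i)%N)).
  rewrite fpsM; apply: le_trans (ler_wpM2r _ (ler_norm_sum _ _ _)) _.
    exact: exprn_ge0.
  rewrite mulr_suml; apply: ler_sum => i _.
  rewrite normrM /a /b mulrACA -exprD subnKC //.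
  by rewrite -ltnS.
apply: le_trans le1 _; rewrite (exchange_big_dep xpredT) //=.
have le2 : \sum_(i < M) a i * w <= v * w.
  by rewrite -mulr_suml ler_wpM2r ?(dom_ge0 gw) ?fv.
apply: le_trans le2; apply: ler_sum => i _; rewrite -mulr_sumr ler_wpM2l //.
apply: le_trans (gw (M - i)%N).
rewrite -(big_geq_mkord i M xpredT (fun m => b (m - i)%N)).
rewrite -{1}[i : nat]add0n big_addn big_mkord.
by apply: ler_sum => l _; rewrite addnK.
Qed.

Lemma dom_const (c : R) : dom (fps_const c) `|c|.
Proof.
case=> [|M]; first by rewrite big_ord0.
rewrite big_ord_recl /= expr0 mulr1 big1 ?addr0 // => i _.
by rewrite normr0 mul0r.
Qed.

Lemma dom_geo1 (y : R) : 0 <= y -> y * x < 1 -> dom (geo y - 1) ((1 - y * x)^-1 - 1).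
Proof.
move=> y0 yx [|M].
  rewrite big_ord0 subr_ge0 invf_ge1 ?subr_gt0 // lerBlDr lerDl mulr_ge0 //.
rewrite big_ord_recl fpsB fps1 /geo expr0 subrr normr0 mul0r add0r.
rewrite (eq_bigr (fun i : 'I_M => (y * x) ^+ i.+1)); last first.
  move=> i _; rewrite lift0 fpsB fps1 subr0 ger0_norm ?exprn_ge0 //.
  by rewrite exprMn.
have yx0 : 0 <= y * x by rewrite mulr_ge0.
rewrite lerBrDl.
have -> : 1 + \sum_(i < M) (y * x) ^+ i.+1 = \sum_(i < M.+1) (y * x) ^+ i.
  by rewrite big_ord_recl expr0.
rewrite -[leRHS]mul1r ler_pdivlMr ?subr_gt0 // mulrC -opprB mulNr -subrX1.
by rewrite opprB gerBl exprn_ge0.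
Qed.

(** Expand FQ - 1 = (F - 1)(Q - 1) + (F - 1) + (Q - 1); as lam^2 <= lam, the quadratic term also
    keeps a single factor lam. *)
Lemma dom_prod1 (s : seq nat) (F : nat -> fps R) (B : nat -> R) (lam : R) :
  0 <= lam <= 1 ->
  (forall k, k \in s -> 1 <= B k /\ dom (F k - 1) (lam * (B k - 1))) ->
  1 <= \prod_(k <- s) B k /\
  dom (\prod_(k <- s) F k - 1) (lam * (\prod_(k <- s) B k - 1)).
Proof.
move=> /andP[l0 l1]; elim: s => [|k s IH] FB.
  by rewrite !big_nil !subrr mulr0; split=> //; apply: dom0.
have [Bk Fk] := FB k (mem_head _ _).
have [|B1 F1] := IH; first by move=> i si; apply: FB; rewrite inE si orbT.
rewrite !big_cons; set P := \prod_(j <- s) B j in B1 F1 *.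
set Q := \prod_(j <- s) F j in F1 *.
split; first by rewrite -[leLHS]mul1r ler_pM.
have -> : F k * Q - 1 = (F k - 1) * (Q - 1) + ((F k - 1) + (Q - 1)) by ring.
apply: (@dom_le _ _ _ (domD (domM Fk F1) (domD Fk F1))).
have ab : 0 <= (B k - 1) * (P - 1) by rewrite mulr_ge0 // subr_ge0.
have ll : lam * lam <= lam by rewrite -[leRHS]mulr1 ler_wpM2l.
have := ler_wpM2r ab ll; nra.
Qed.
End Majorant.

(** * Bounds at radius 1/16 and decay of the error *)

Section Estimates.
Variable R : realType.

Definition tau : R := 16^-1.
(* The value of [geo l%:R^-1] at [tau]; hence [gprod] is the value of [PF]. *)
Definition gfac l : R := (1 - l%:R^-1 * tau)^-1.
Definition gprod k : R := \prod_(1 <= l < k.+1) gfac l.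

Lemma tau_ge0 : 0 <= tau.
Proof. by rewrite invr_ge0. Qed.

Lemma inv_nat_bounds l : (0 < l)%N -> 0 < (l%:R^-1 : R) <= 1.
Proof.
move=> l0; rewrite invr_gt0 ltr0n l0 /= invf_le1 ?ltr0n // ler1n //.
Qed.

Lemma gfac_ge1 l : (0 < l)%N -> 1 <= gfac l.
Proof.
move=> /inv_nat_bounds /andP[a0 a1]; rewrite /gfac invf_ge1 /tau; lra.
Qed.

Lemma gfac_le2 l : (0 < l)%N -> gfac l <= 2.
Proof.
move=> /inv_nat_bounds /andP[a0 a1]; rewrite /gfac invf_ple ?posrE /tau; lra.
Qed.

Lemma gprodS k : gprod k.+1 = gprod k * gfac k.+1.
Proof. by rewrite /gprod big_nat_recr. Qed.

Lemma gprod_ge1 k : 1 <= gprod k.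
Proof.
elim: k => [|k IH]; first by rewrite /gprod big_geq.
by rewrite gprodS -[leLHS]mul1r ler_pM // gfac_ge1.
Qed.

Lemma gprod_homo : {homo gprod : m n / (m <= n)%N >-> m <= n}.
Proof.
apply: homo_leq => [//|y x z|k]; first exact: le_trans.
by rewrite gprodS ler_peMr ?gfac_ge1 // (le_trans ler01) // gprod_ge1.
Qed.

(** With a = 1/(k + 1), Bernoulli's inequality gives [gfac k.+1 ^+ 8] <= 1/(1 - a/2) <= 1 + a = (k +
    2)/(k + 1). *)
Lemma gprod_exp8 k : gprod k ^+ 8 <= k.+1%:R.
Proof.
elim: k => [|k IH]; first by rewrite /gprod big_geq // expr1n.
rewrite gprodS exprMn.
have a0 := inv_nat_bounds (ltn0Sn k).
have kK : k.+1%:R * k.+1%:R^-1 = 1 :> R by rewrite divff.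
have k1 : 1 <= k.+1%:R :> R by rewrite ler1n.
set a := k.+1%:R^-1 in a0 kK *.
have f8 : gfac k.+1 ^+ 8 <= (1 - 8 * (a * tau))^-1.
  rewrite /gfac -/a exprVn /tau.
  have y0 : 0 <= a * 16^-1 <= 16^-1 by lra.
  move: (a * 16^-1) y0 => y y0.
  rewrite lef_pV2 ?posrE; [|by rewrite exprn_gt0 //; lra|lra].
  have h2 : 1 - 2 * y <= (1 - y) ^+ 2 by nra.
  have h4 : 1 - 4 * y <= (1 - y) ^+ 4.
    rewrite (exprM _ 2 2); apply: le_trans (_ : (1 - 2 * y) ^+ 2 <= _); first by nra.
    rewrite lerXn2r ?nnegrE //; nra.
  rewrite (exprM _ 4 2); apply: le_trans (_ : (1 - 4 * y) ^+ 2 <= _); first by nra.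
  rewrite lerXn2r ?nnegrE //; nra.
apply: le_trans (ler_pM _ _ IH f8) _; rewrite ?exprn_ge0 //.
- by rewrite (le_trans ler01) // gprod_ge1.
- by rewrite (le_trans ler01) // gfac_ge1.
rewrite ler_pdivrMr /tau; last lra.
by rewrite -[k.+2]addn1 natrD; nra.
Qed.

(** Keep only the terms of degree at most 1 in [tau] of the product; 16 is 1/[tau]. *)
Lemma harm_gprod k : \sum_(1 <= i < k.+1) i%:R^-1 <= 16 * gprod k.
Proof.
suff : 1 + tau * \sum_(1 <= i < k.+1) i%:R^-1 <= gprod k.
  rewrite /tau => h; have := gprod_ge1 k; lra.
elim: k => [|k IH]; first by rewrite /gprod !big_geq // mulr0 addr0.
rewrite gprodS big_nat_recr //=.
have a0 := inv_nat_bounds (ltn0Sn k).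
set a := k.+1%:R^-1 in a0 *.
have g1 : 1 + a * tau <= gfac k.+1.
  rewrite /gfac -/a -[leRHS]mul1r ler_pdivlMr /tau; nra.
have [a_gt0 _] := andP a0.
have s0 : 0 <= \sum_(1 <= i < k.+1) i%:R^-1 :> R by apply: sumr_ge0.
apply: le_trans (_ : (1 + tau * \sum_(1 <= i < k.+1) i%:R^-1) * (1 + a * tau) <= _).
  rewrite -subr_ge0; set S := \sum_(_ <= _ < _) _ in s0 *.
  have -> : (1 + tau * S) * (1 + a * tau) - (1 + tau * (S + a)) = tau ^+ 2 * (S * a).
    by ring.
  by rewrite mulr_ge0 ?exprn_ge0 ?tau_ge0 // mulr_ge0 // ltW.
by apply: ler_pM => //; rewrite addr_ge0 ?mulr_ge0 ?tau_ge0 // ltW.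
Qed.

Definition qsum_bound : R := 4 * gprod 1 ^+ 2.

(* Telescoping: gprod k ^ 2 / k^2 <= 4 (y_k - y_(k+1)) with y_k = gprod k ^ 2 / k. *)
Lemma gprod2_sum N : \sum_(1 <= k < N.+1) gprod k ^+ 2 / k%:R ^+ 2 <= qsum_bound.
Proof.
suff : \sum_(1 <= k < N.+1) gprod k ^+ 2 / k%:R ^+ 2
    <= 4 * (gprod 1 ^+ 2 - gprod N.+1 ^+ 2 / N.+1%:R).
  move/le_trans; apply; rewrite /qsum_bound ler_wpM2l // gerBl.
  by rewrite mulr_ge0 ?exprn_ge0 ?invr_ge0 // (le_trans ler01) // gprod_ge1.
elim: N => [|N IH]; first by rewrite big_geq // divr1 subrr mulr0.
rewrite big_nat_recr //=; apply: le_trans (lerD IH (lexx _)) _.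
suff : gprod N.+1 ^+ 2 / N.+1%:R ^+ 2 <=
    4 * (gprod N.+1 ^+ 2 / N.+1%:R - gprod N.+2 ^+ 2 / N.+2%:R).
  set u := gprod 1 ^+ 2; set w := _ / N.+2%:R; set z := _ / N.+1%:R => key.
  have -> : 4 * (u - w) = 4 * (u - z) + 4 * (z - w) by ring.
  by rewrite lerD2l.
rewrite [gprod N.+2]gprodS exprMn; set p := gprod N.+1 ^+ 2.
have p0 : 0 <= p by rewrite exprn_ge0 // (le_trans ler01) // gprod_ge1.
rewrite -[p * _ / _]mulrA -mulrBr mulrCA ler_wpM2l // /gfac exprVn -invfM.
have k1 : 1 <= N.+1%:R :> R by rewrite ler1n.
have -> : N.+2%:R = N.+1%:R + 1 :> R by rewrite -natr1.
move: (N.+1%:R : R) k1 => k k1.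
(* The square costs at most 2 [tau] = 1/8 in the denominator, well below 1/2. What remains is 4 (1/k
   - 1/(k + 1/2)) = 2/(k (k + 1/2)) >= 1/k^2. *)
have h : ((1 - (k + 1)^-1 * tau) ^+ 2 * (k + 1))^-1 <= (k + 2^-1)^-1.
  have kK : (k + 1) * (k + 1)^-1 = 1 by rewrite divff // gt_eqF //; lra.
  have a0 : 0 < (k + 1)^-1 by rewrite invr_gt0; lra.
  have e : (1 - (k + 1)^-1 * tau) ^+ 2 * (k + 1) = k + 1 - 2 * tau + tau ^+ 2 * (k + 1)^-1.
    transitivity (k + 1 - 2 * tau * ((k + 1) * (k + 1)^-1)
       + tau ^+ 2 * (k + 1)^-1 * ((k + 1) * (k + 1)^-1)); first by ring.
    by rewrite kK !mulr1.
  have t0 : 0 <= tau ^+ 2 * (k + 1)^-1 by rewrite mulr_ge0 ?exprn_ge0 ?tau_ge0 // ltW.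
  by rewrite e lef_pV2 ?posrE /tau; move: t0; rewrite /tau; lra.
apply: le_trans (_ : 4 * (k^-1 - (k + 2^-1)^-1) <= _); last first.
  by rewrite ler_wpM2l // lerB.
have -> : 4 * (k^-1 - (k + 2^-1)^-1) = 2 * (k * (k + 2^-1))^-1.
  by field; rewrite !gt_eqF //; lra.
rewrite -[leLHS]mul1r ler_pdivrMr ?exprn_gt0 //; last lra.
rewrite -mulrA mulrC -!mulrA ler_pdivlMl //; [nra|]; rewrite mulr_gt0 //; lra.
Qed.

Lemma gprod_ge0 k : 0 <= gprod k.
Proof. by rewrite (le_trans ler01) // gprod_ge1. Qed.

Local Notation dom := (dom tau).
Local Notation ratio := (ratioPQ (fpsX R) (@vf R) (@rf R)).
Local Notation term k := (rf R k * eterm (@vf R) (@rf R) k).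

Lemma dom_geo l : (0 < l)%N -> dom (geo l%:R^-1) (gfac l).
Proof.
move=> l0; have /andP[a0 a1] := inv_nat_bounds l0.
have -> : geo l%:R^-1 = (geo l%:R^-1 - 1) + fps_const 1 :> fps R by rewrite subrK.
have h : l%:R^-1 * tau < 1 by rewrite /tau; lra.
have := domD tau_ge0 (dom_geo1 tau_ge0 (ltW a0) h) (dom_const tau (1 : R)).
by move/dom_le; apply; rewrite normr1 subrK.
Qed.

Lemma dom_PF k : dom (PF R k) (gprod k).
Proof.
elim: k => [|k IH].
  rewrite /PF /prodP /gprod !big_geq //.
  by have := dom_const tau (1 : R); rewrite normr1.
by rewrite PFS gprodS mulrC; apply: domM => //; [exact: tau_ge0 | exact: dom_geo].
Qed.

Lemma dom_vf k : dom (vf R k) k%:R^-1.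
Proof.
have := dom_const tau (k%:R^-1 : R).
by rewrite ger0_norm ?invr_ge0.
Qed.

Lemma dom_rf k : (0 < k)%N -> dom (rf R k) (2 * k%:R^-1).
Proof.
move=> k0; have /andP[a0 _] := inv_nat_bounds k0.
apply: dom_le (domM tau_ge0 (dom_vf k) (dom_geo k0)) _.
by rewrite mulrC ler_wpM2r ?gfac_le2 // ltW.
Qed.

Lemma dom_term k : (0 < k)%N -> dom (term k) (96 * (gprod k ^+ 2 / k%:R ^+ 2)).
Proof.
move=> k0; have t0 := tau_ge0.
have hr : dom (rsum (@rf R) k) (32 * gprod k).
  apply: (@dom_le _ _ _ (\sum_(1 <= i < k.+1) 2 * i%:R^-1)).
    apply: dom_sum => // i; rewrite mem_index_iota => /andP[i0 _].
    exact: dom_rf.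
  rewrite -mulr_sumr (_ : 32 = 2 * 16 :> R); last by ring.
  by rewrite -mulrA ler_wpM2l // harm_gprod.
have hh : dom (harm (@vf R) k.-1) (16 * gprod k).
  apply: (@dom_le _ _ _ (\sum_(1 <= i < k.-1.+1) i%:R^-1)).
    by apply: dom_sum => // i _; exact: dom_vf.
  apply: le_trans (harm_gprod _) _.
  by rewrite ler_wpM2l // gprod_homo // leq_pred.
(* The constant is 96 = 2 (32 + 16). *)
have := domM t0 (dom_rf k0) (domM t0 (domM t0 (dom_vf k) (dom_PF k)) (domB t0 hr hh)).
rewrite -/(PF R k) /eterm /bterm => /dom_le; apply.
by rewrite le_eqVlt; apply/orP; left; apply/eqP; field; rewrite pnatr_eq0 -lt0n.
Qed.

Lemma PF_addn M k :
  PF R (M + k) = PF R M * \prod_(1 <= s < k.+1) geo (M + s)%:R^-1.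
Proof.
elim: k => [|k IH]; first by rewrite addn0 [\prod_(_ <= _ < _) _]big_geq // mulr1.
by rewrite addnS PFS IH [in RHS]big_nat_recr //= addnS mulrC mulrA.
Qed.

Lemma ratioPQ_geo N k : (k <= N)%N ->
  ratio N k = \prod_(1 <= s < k.+1) geo (N - k + s)%:R^-1.
Proof.
move=> kN; rewrite /ratioPQ -/(PF R N) -{1}(subnK kN) PF_addn mulrAC.
rewrite (prodP_Q (@vf_natK R) (@rf_natK R)).
by rewrite mul1r.
Qed.

(** 1/(1 - z tau) - 1 is z times an increasing function of z, and y <= b. *)
Lemma gfac_scale (y lam b : R) : 0 <= y -> 0 < b <= 1 -> y <= lam * b -> 0 <= lam <= 1 ->
  (1 - y * tau)^-1 - 1 <= lam * ((1 - b * tau)^-1 - 1).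
Proof.
move=> y0 /andP[b0 b1] yl /andP[l0 l1].
have yb : y <= b by nra.
have t16 : tau = 16^-1 by [].
have e z : z <= 1 -> (1 - z * tau)^-1 - 1 = (z * tau) * (1 - z * tau)^-1.
  by move=> z1; field; rewrite gt_eqF // t16; lra.
rewrite e ?(le_trans yb) // e // !mulrA.
apply: ler_pM; rewrite ?mulr_ge0 ?tau_ge0 //.
- by rewrite invr_ge0 t16; lra.
- by rewrite ler_wpM2r ?tau_ge0.
- by rewrite lef_pV2 ?posrE t16; lra.
Qed.

(** Compare the factor of index N - k + s with factor s of [gprod k], taking lam = k/N: the
    condition s N <= k (N - k + s) says (N - k)(k - s) >= 0. *)
Lemma dom_ratio N k : (0 < k <= N)%N ->
  dom (ratio N k - 1) (k%:R / N%:R * gprod k).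
Proof.
move=> /andP[k0 kN]; rewrite ratioPQ_geo //.
have N0 : 0 < N%:R :> R by rewrite ltr0n; lia.
have l0 : 0 <= (k%:R / N%:R : R) <= 1.
  apply/andP; split; first exact: divr_ge0.
  by rewrite ler_pdivrMr // mul1r ler_nat.
have [|_ h] := @dom_prod1 R tau tau_ge0 (index_iota 1 k.+1)
  (fun s => geo (N - k + s)%:R^-1) gfac _ l0.
  move=> s; rewrite mem_index_iota => /andP[s0 sk]; split; first exact: gfac_ge1.
  have b0 := inv_nat_bounds s0.
  have Ns : (0 < N - k + s)%N by lia.
  have /andP[y0 y1] := inv_nat_bounds Ns.
  apply: dom_le (dom_geo1 tau_ge0 (ltW y0) _) _; first by rewrite /tau; lra.
  apply: gfac_scale => //.
  rewrite -[leLHS]mul1r ler_pdivrMr ?ltr0n //.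
  have -> : k%:R / N%:R / s%:R * (N - k + s)%:R = (k * (N - k + s))%:R / (N * s)%:R :> R.
    by rewrite !natrM invfM; ring.
  rewrite ler_pdivlMr ?ltr0n ?muln_gt0 ?s0 ?(leq_trans k0) // mul1r ler_nat.
  nia.
apply: dom_le h _; rewrite ler_wpM2l //; last by rewrite lerBlDr lerDl.

Qed.

(** The factor k/N from [dom_ratio] turns the 1/k^2 of [dom_term] into 1/(N k); the remaining
    harmonic sum costs 16 [gprod N], and 96 * 16 = 1536. *)
Lemma dom_error N : (0 < N)%N ->
  dom (usum (fpsX R) (@rf R) N - \sum_(1 <= k < N.+1) term k)
      (1536 * (gprod N ^+ 4 / N%:R)).
Proof.
move=> N0; rewrite -(lsum_usum (@vf_natK R) (@rf_natK R)) /lsum -sumrB.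
have t0 := tau_ge0.
have N0' : 0 <= N%:R^-1 :> R by [].
apply: (@dom_le _ _ _ (\sum_(1 <= k < N.+1) 96 * gprod N ^+ 3 / N%:R * k%:R^-1)); last first.
  rewrite -mulr_sumr.
  have -> : 1536 * (gprod N ^+ 4 / N%:R) = 96 * gprod N ^+ 3 / N%:R * (16 * gprod N).
    by ring.
  by rewrite ler_wpM2l ?harm_gprod // !mulr_ge0 ?exprn_ge0 ?gprod_ge0.
apply: dom_sum => // k; rewrite mem_index_iota => /andP[k0 kN].
have -> : ratio N k * term k - term k = (ratio N k - 1) * term k by ring.
have kN' : (0 < k <= N)%N by rewrite k0.
apply: dom_le (domM t0 (dom_ratio kN') (dom_term k0)) _.
have -> : k%:R / N%:R * gprod k * (96 * (gprod k ^+ 2 / k%:R ^+ 2)) =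
    96 * gprod k ^+ 3 / N%:R * k%:R^-1.
  by field; rewrite !pnatr_eq0 -!lt0n k0 N0.
rewrite !ler_wpM2r ?invr_ge0 // ler_wpM2l // lerXn2r ?nnegrE ?gprod_ge0 //.
by rewrite gprod_homo.
Qed.

Lemma error_coef_cvg m :
  (fun N => (usum (fpsX R) (@rf R) N - \sum_(1 <= k < N.+1) term k) m) @ \oo --> (0 : R).
Proof.
have t0 : 0 < tau by rewrite invr_gt0.
apply/cvgr0Pnorm_le => eps e0.
(* Extracting the coefficient m from the norm costs [tau ^- m]. *)
pose C := 1536 * tau ^- m.
have C0 : 0 < C by apply: mulr_gt0; [rewrite ltr0n | rewrite invr_gt0 exprn_gt0].
pose d := eps / (4 * C).
have d0 : 0 < d by rewrite divr_gt0 // mulr_gt0.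
near=> N.
have N0 : (0 < N)%N by near: N; exists 1%N.
have Nb : C / (2 * d * eps) <= N%:R by near: N; exact: nbhs_infty_ger.
have N0' : 1 <= N%:R :> R by rewrite ler1n.
apply: le_trans (_ : C * (gprod N ^+ 4 / N%:R) <= _).
  have := dom_coef (ltW t0) m (dom_error N0).
  rewrite -ler_pdivlMr ?exprn_gt0 // => /le_trans; apply.
  by rewrite /C mulrAC.
rewrite mulrA ler_pdivrMr; last by rewrite ltr0n.
have p8 := gprod_exp8 N; rewrite -natr1 in p8.
(* Young's inequality g^4 <= d g^8 + 1/(4d) with g^8 <= N + 1 <= 2N. The choice of d makes the first
   part eps N / 2 after multiplication by C, and [Nb] bounds the second by the same. *)
have p4 : gprod N ^+ 4 <= d * N%:R * 2 + (4 * d)^-1.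
  apply: le_trans (_ : d * gprod N ^+ 8 + (4 * d)^-1 <= _); last first.
    rewrite lerD2r -mulrA ler_wpM2l ?(ltW d0) //; lra.
  rewrite -subr_ge0 (_ : _ - _ = d * (gprod N ^+ 4 - (2 * d)^-1) ^+ 2).
    by rewrite mulr_ge0 ?(ltW d0) ?sqr_ge0.
  by field; rewrite gt_eqF.
apply: le_trans (_ : C * (d * N%:R * 2 + (4 * d)^-1) <= _).
  by rewrite ler_wpM2l // ltW.
rewrite mulrDr.
have -> : C * (d * N%:R * 2) = eps * N%:R / 2.
  by rewrite /d; field; rewrite gt_eqF.
have -> : C * (4 * d)^-1 = C / (2 * d * eps) * eps / 2.
  by field; rewrite !gt_eqF.
have := ler_wpM2r (ltW e0) Nb; lra.
Unshelve. all: by end_near.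
Qed.
End Estimates.

(** * Convergence of the truncated sums *)

Section Convergence.
Variable R : realType.

(** [limn] stands for an actual limit only once convergence is known; all the series here have
    nonnegative terms. *)
Lemma cvg_sum_bounded (f : nat -> R) (B : R) :
  (forall k, 0 <= f k) -> (forall N, \sum_(1 <= k < N.+1) f k <= B) ->
  cvgn (fun N => \sum_(1 <= k < N.+1) f k).
Proof.
move=> f0 fB; apply: nondecreasing_is_cvgn.
  by apply/nondecreasing_seqP => N; rewrite [leRHS]big_nat_recr //= lerDl.
by exists B => _ [N _ <-].
Qed.

Lemma msum_lt_ge0 rs N : 0 <= msum_lt R rs N.
Proof.
elim: rs N => [|a rs IH] N //=; apply: sumr_ge0 => k _.
by rewrite mulr_ge0 // invr_ge0 exprn_ge0.
Qed.

Lemma msum_le_ge0 rs N : 0 <= msum_le R rs N.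
Proof.
elim: rs N => [|a rs IH] N //=; apply: sumr_ge0 => k _.
by rewrite mulr_ge0 // invr_ge0 exprn_ge0.
Qed.

Lemma exprV_le2 k a : (2 <= a)%N -> k%:R ^- a <= k%:R ^- 2 :> R.
Proof.
move=> a2; case: k => [|k]; first by rewrite !expr0n /=; case: a a2.
by rewrite lef_pV2 ?posrE ?exprn_gt0 ?ltr0n // ler_weXn2l // ler1n.
Qed.

Lemma sum_inv_sqr N : \sum_(1 <= k < N.+1) k%:R ^- 2 <= qsum_bound R.
Proof.
apply: le_trans (gprod2_sum R N); apply: ler_sum => k _.
by rewrite ler_peMl ?invr_ge0 ?exprn_ge0 // exprn_ege1 // gprod_ge1.
Qed.

Lemma msum_lt_bound rs N : all (leq 2) rs ->
  msum_lt R rs N <= qsum_bound R ^+ size rs.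
Proof.
elim: rs N => [|a rs IH] N //= /andP[a2 rs2]; rewrite exprS.
have B0 : 0 <= qsum_bound R ^+ size rs by apply: le_trans (msum_lt_ge0 rs 0) (IH 0%N rs2).
apply: le_trans (_ : \sum_(1 <= k < N.+1) k%:R ^- 2 * qsum_bound R ^+ size rs <= _).
  apply: ler_sum => k _.
  by rewrite ler_pM ?invr_ge0 ?exprn_ge0 ?msum_lt_ge0 ?exprV_le2 ?IH.
by rewrite -mulr_suml ler_wpM2r // sum_inv_sqr.
Qed.

Lemma cvg_msum_lt rs : all (leq 2) rs -> cvgn (msum_lt R rs).
Proof.
case: rs => [|a rs] rs2; first exact: is_cvg_cst.
apply: (@cvg_sum_bounded _ (qsum_bound R ^+ size (a :: rs))).
  by move=> k; rewrite mulr_ge0 ?msum_lt_ge0 // invr_ge0 exprn_ge0.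
by move=> N; exact: (msum_lt_bound N rs2).
Qed.

(** A coefficient bound for [PF k] read off from its norm; this growth is slow enough to be summed
    against 1/k^2. *)
Lemma msum_le_ones p k : msum_le R (nseq p 1%N) k <= gprod R k / tau R ^+ p.
Proof.
have t0 : 0 < tau R by rewrite invr_gt0 ltr0n.
have := dom_coef (ltW t0) p (dom_PF R k).
by rewrite PF_coef ger0_norm ?msum_le_ge0 // ler_pdivlMr ?exprn_gt0.
Qed.

Lemma cvg_msum_le_ones q p : (2 <= q)%N -> cvgn (msum_le R (q :: nseq p 1%N)).
Proof.
move=> q2; apply: (@cvg_sum_bounded _ (qsum_bound R / tau R ^+ p)).
  by move=> k; rewrite mulr_ge0 ?msum_le_ge0 // invr_ge0 exprn_ge0.
move=> N.
have t0 : 0 <= (tau R ^+ p)^-1 by rewrite invr_ge0 exprn_ge0 ?tau_ge0.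
apply: le_trans (ler_wpM2r t0 (gprod2_sum R N)); rewrite mulr_suml.
apply: ler_sum => k _; rewrite [leRHS]mulrAC [leRHS]mulrC.
apply: ler_pM; rewrite ?invr_ge0 ?exprn_ge0 ?msum_le_ge0 ?exprV_le2 //.
apply: le_trans (msum_le_ones _ _) _; rewrite ler_wpM2r // expr2.
by rewrite ler_peMr ?gprod_ge1 // gprod_ge0.
Qed.

Lemma cvg_G_trunc q p : (2 <= q)%N -> cvgn (G_trunc R q 1 p).
Proof.
move=> q2; apply: (@cvg_sum_bounded _ (16 * (qsum_bound R / tau R ^+ p))).
  by move=> k; rewrite !mulr_ge0 ?msum_le_ge0 ?msum_lt_ge0 // invr_ge0 exprn_ge0.
move=> N.
have t0 : 0 <= (tau R ^+ p)^-1 by rewrite invr_ge0 exprn_ge0 ?tau_ge0.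
rewrite mulrA; have c0 : 0 <= 16 / tau R ^+ p by rewrite mulr_ge0.
rewrite [leRHS]mulrAC; apply: le_trans (ler_wpM2l c0 (gprod2_sum R N)).
rewrite mulr_sumr; apply: ler_sum => k _.
have -> : 16 / tau R ^+ p * (gprod R k ^+ 2 / k%:R ^+ 2) =
   k%:R ^- 2 * (16 * gprod R k) * (gprod R k / tau R ^+ p) by ring.
have h1 : msum_lt R (nseq 1 1%N) k.-1 <= 16 * gprod R k.
  rewrite /=; under eq_bigr do rewrite mulr1 expr1.
  apply: le_trans (harm_gprod _ _) _.
  by rewrite ler_wpM2l // gprod_homo // leq_pred.
by do 2!(apply: ler_pM;
  rewrite ?mulr_ge0 ?invr_ge0 ?exprn_ge0 ?msum_le_ge0 ?msum_lt_ge0 ?exprV_le2 ?msum_le_ones //).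
Qed.

Lemma mzv_star_ones p q :
  mzv_star R (nseq p 1%N ++ [:: q]) = limn (msum_le R (q :: nseq p 1%N)).
Proof. by rewrite /mzv_star rev_cat rev_nseq. Qed.
End Convergence.

(** * Passage to the limit in the truncated identity *)

Lemma cvg_big_sum (R : realType) (I : Type) (s : seq I) (P : pred I)
    (u : I -> nat -> R) (l : I -> R) :
  (forall i, P i -> u i @ \oo --> l i) ->
  (fun N => \sum_(i <- s | P i) u i N) @ \oo --> \sum_(i <- s | P i) l i.
Proof.
move=> ul; elim: s => [|i s IH].
  by under eq_fun do rewrite big_nil; rewrite big_nil; exact: cvg_cst.
under eq_fun do rewrite big_cons; rewrite big_cons.
by case: ifP => // /ul ui; exact: cvgD.
Qed.

Theorem theorem5p3 (R : realType) (n : nat) :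
  \sum_(p < (2 * n + 2)%N)
     ((p.+1)%:R * mzv_star R (nseq p.+1 1%N ++ [:: ((2 * n + 1 - p) + 2)%N]))
  - \sum_(p < (2 * n + 2)%N) G R ((2 * n + 1 - p) + 2)%N 1%N p
  = ('C((2 * n + 4)%N, 3))%:R * mzv R [:: (2 * n + 4)%N]
    + \sum_(1 <= j < n.+1)
        (-1) ^+ j *
        \sum_(c : {ffun 'I_j.+1 -> 'I_((2 * n + 2 - 2 * j)%N)}
               | (\sum_(i < j.+1) (c i : nat) == 2 * n + 1 - 2 * j)%N)
          (mzv R [seq (if i == ord0 then (c i + 3)%N else (c i + 2)%N)
                 | i <- enum 'I_j.+1]
           * (('C((c ord0 + 3)%N, 3))%:R
              * \prod_(i < j.+1 | i != ord0) ((c i : nat).+1)%:R)).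
Proof.
set L := LHS; set r := RHS.
pose A N : R := (\sum_(1 <= k < N.+1) rf R k * eterm (@vf R) (@rf R) k) (2 * n + 1)%N.
pose U N : R := (usum (fpsX R) (@rf R) N) (2 * n + 1)%N.
have AL : A @ \oo --> L.
  rewrite /L -sumrB [A](funext (fun N => sum_rf_eterm_coef R N (2 * n + 1))) -addnS.
  apply: cvg_big_sum => p _; apply: cvgB.
    apply: cvgMl_tmp; rewrite mzv_star_ones.
    by apply: cvg_msum_le_ones; rewrite addn2.
  by apply: cvg_G_trunc; rewrite addn2.
have Ur : U @ \oo --> r.
  have UE N : U N = 'C(2 * n + 4, 3)%:R * msum_lt R [:: (2 * n + 4)%N] N +
      \sum_(1 <= j < n.+1) (-1) ^+ j *
        \sum_(c : {ffun 'I_j.+1 -> 'I_(2 * n + 2 - 2 * j)}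
           | (\sum_(i < j.+1) (c i : nat) == 2 * n + 1 - 2 * j)%N)
          (msum_lt R (rev (exponents c)) N * weight R c).
    rewrite /U usum_coef -(big_mkord xpredT
      (fun j => (-1) ^+ j * Tf R j N (2 * n + 1 - 2 * j)%N)).
    (* The term j = 0 is the one with the single value zeta(2n + 4); [Tf_coef] handles the
       others. *)
    rewrite big_ltn // muln0 subn0 mul1r; congr (_ + _).
      rewrite /Tf fps_sum /= mulr_sumr; apply: eq_big_nat => k /andP[k0 _].
      by rewrite nat_rf4_coef // mulr1 -addnA.
    apply: eq_big_nat => j /andP[j0 jn]; congr (_ * _); apply: Tf_coef; lia.
  rewrite [U](funext UE).
  apply: cvgD.
    apply: cvgMl_tmp; rewrite /mzv; apply: cvg_msum_lt => /=; lia.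
  apply: cvg_big_sum => j _; apply: cvgMl_tmp; apply: cvg_big_sum => c _.
  apply: cvgMr_tmp; rewrite /mzv; apply: cvg_msum_lt.
  rewrite all_rev; apply/allP => _ /mapP[i _ ->]; case: ifP => _; lia.
have UA : (fun N => U N - A N) @ \oo --> (0 : R) := error_coef_cvg _.
(* [U - A] tends both to [r - L] and to 0. *)
apply/esym/eqP; rewrite -subr_eq0; apply/eqP.
exact: (cvg_unique (@Rhausdorff R) (cvgB Ur AL) UA).
Qed.
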